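(* The past stress satisfies $$\sigma\,\mathcal P(\delta x_t,W_t)=\tfrac12\left(\delta x_t-\delta\hat x_t\right)^TP_t^{-1}\left(\delta x_t-\delta\hat x_t\right),$$ where $P_t$ and $\delta\hat x_t$ are subject to the following recursion: $$\delta\hat x_{t+1}=f^x_t\delta\hat x_t+f^u_t\delta u_t+\bar f_{t+1}+G_t\left(\delta y_{t+1}-h^x_t\delta\hat x_t\right)-\sigma f^x_tH_t\left(l^{xx}_t\delta\hat x_t+l^{xu}_t\delta u_t+l^x_t\right),$$ $$H_t=\left(P_t^{-1}+h^{x^T}_t\Gamma_{t+1}^{-1}h^x_t+\sigma l^{xx}_t\right)^{-1},$$ $$G_t=f^x_tH_th^{x^T}_t\Gamma_{t+1}^{-1},$$ $$P_{t+1}=\Omega_{t+1}+f^x_tH_tf^{x^T}_t.$$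
   Context: Fix a horizon $T$ and a scalar sensitivity parameter $\sigma$. Consider the system $x_{t+1}=f_t(x_t,u_t)+\omega_{t+1}$, $y_{t+1}=h_t(x_t)+\gamma_{t+1}$, where $x_t,u_t,y_t$ are the state, control and observation, with $x_0\sim\mathcal N(\hat x_0,\chi_0)$, independent Gaussian noises $\omega_t\sim\mathcal N(0,\Omega_t)$, $\gamma_t\sim\mathcal N(0,\Gamma_t)$, and cost $l_T(x_T)+\sum_{t=0}^{T-1}l_t(x_t,u_t)$. All functions are $\mathcal C^2$. The information available at time $t$ is $W_t=(\hat x_0,y_{1:t},u_{0:t-1})$. Along a nominal trajectory $(x^n_t)$, $(u^n_t)$ (not necessarily dynamically feasible), let $\delta x_t=x_t-x^n_t$, $\delta u_t=u_t-u^n_t$, $\delta y_{t+1}=y_{t+1}-h_t(x^n_t)$; let $f^x_t,f^u_t,h^x_t$ be the Jacobians of $f_t$ and $h_t$, and $l^x_t,l^u_t,l^{xx}_t,l^{xu}_t,l^{ux}_t,l^{uu}_t$ the gradients and second derivatives of $l_t$, all evaluated along the nominal trajectory; and let $\bar f_{t+1}=f_t(x^n_t,u^n_t)-x^n_{t+1}$ be the feasibility gap. The approximate model has linear dynamics $$\delta x_{t+1}=f^x_t\delta x_t+f^u_t\delta u_t+\bar f_{t+1}+\omega_{t+1},\qquad \delta y_{t+1}=h^x_t\delta x_t+\gamma_{t+1},$$ and quadratic stage cost $$\delta l_t=\tfrac12\begin{bmatrix}1\\ \delta x_t\\ \delta u_t\end{bmatrix}^T\begin{bmatrix}0&l^{x^T}_t&l^{u^T}_t\\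 l^x_t&l^{xx}_t&l^{xu}_t\\ l^u_t&l^{ux}_t&l^{uu}_t\end{bmatrix}\begin{bmatrix}1\\ \delta x_t\\ \delta u_t\end{bmatrix}.$$ Let $d_t=\tfrac12\omega_t^T\Omega_t^{-1}\omega_t+\tfrac12\gamma_t^T\Gamma_t^{-1}\gamma_t$, where $\omega_t=\delta x_t-f^x_{t-1}\delta x_{t-1}-f^u_{t-1}\delta u_{t-1}-\bar f_t$ and $\gamma_t=\delta y_t-h^x_{t-1}\delta x_{t-1}$. The past stress $\mathcal P(\delta x_t,W_t)$ (its time index is read off from its arguments) is defined, for the controls and observations recorded in $W_t$, by the recursion $$\mathcal P(\delta x_t,W_t)=\operatorname*{ext}_{\delta x_{t-1}}\left\{\delta l_{t-1}+\sigma^{-1}d_t+\mathcal P(\delta x_{t-1},W_{t-1})\right\},$$ with boundary condition that at time $0$ the quantity $\sigma\mathcal P$ equals $\tfrac12(x_0-\hat x_0)^T\chi_0^{-1}(x_0-\hat x_0)$; correspondingly the recursion for $P_t$, $\delta\hat x_t$ starts from $P_0=\chi_0$ and $\delta\hat x_0=\hat x_0-x^n_0$. Here $\operatorname{ext}$ denotes an extremization, i.e. computation of either a maximum or a minimum; a variable is said to extremize if it minimizes when $\sigma<0$ and maximizes when $\sigma>0$.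
   Formalization: The equality is stated up to an additive constant independent of δx_t (the literal equality fails, e.g. with zero costs and δy_1 ≠ h δx̂_0); the extrema are assumed attained and the matrix inverted in H_t invertible. *)

(* Defs.v *)
From HB Require Import structures.
From mathcomp Require Import all_boot all_order all_algebra.
From mathcomp Require Import all_classical all_reals all_analysis.

Set Implicit Arguments.
Unset Strict Implicit.
Unset Printing Implicit Defensive.

Import Order.TTheory GRing.Theory Num.Theory.
Import numFieldNormedType.Exports.

Local Open Scope classical_set_scope.
Local Open Scope ring_scope.

(* For a finite-dimensional V this is the usual class C^2: all directional
   (equivalently, partial) derivatives of order at most 2 exist and are
   continuous. *)
Definition C2 (R : realType) (V W : normedModType R) (f : V -> W) : Prop :=
  [/\ continuous f,
      forall v, (forall x, derivable f x v) /\ continuous ('D_v f) &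
      forall v w, (forall x, derivable ('D_v f) x w) /\
                  continuous ('D_w ('D_v f))].

(* The (i, j) entry is the partial derivative of F_i with respect to x_j. *)
Definition jac (R : realType) (a b : nat) (F : 'cV[R]_a -> 'cV[R]_b)
    (x : 'cV[R]_a) : 'M[R]_(b, a) :=
  \matrix_(i, j) 'D_(delta_mx j 0) (fun z => F z i 0 : R^o) x.

Definition grad (R : realType) (a : nat) (g : 'cV[R]_a -> R)
    (x : 'cV[R]_a) : 'cV[R]_a :=
  \col_j 'D_(delta_mx j 0) (g : 'cV[R]_a -> R^o) x.

Definition qform (R : realType) (a : nat) (A : 'M[R]_a) (x : 'cV[R]_a) : R :=
  (x^T *m A *m x) 0 0.

Definition posdef (R : realType) (a : nat) (A : 'M[R]_a) : Prop :=
  A^T = A /\ forall x : 'cV[R]_a, x != 0 -> 0 < qform A x.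

(* An extremization is the computation of either a maximum or a minimum.
   [ext s g] is that maximum or minimum only when [ext_attained s g] holds;
   otherwise it is a junk value of [sup] or [inf], or an unattained bound.
   A variable that "extremizes" uses Minimum for sigma < 0 and Maximum for
   sigma > 0; the sense is kept as a free parameter, so both that convention
   and the opposite one are covered. *)
Variant sense := Minimum | Maximum.

Definition ext (R : realType) (X : Type) (s : sense) (g : X -> R) : R :=
  match s with
  | Minimum => inf (range g)
  | Maximum => sup (range g)
  end.

Definition ext_attained (R : realType) (X : Type) (s : sense) (g : X -> R) :
    Prop :=
  exists x, forall y,
    match s with
    | Minimum => g x <= g y
    | Maximum => g y <= g x
    end.

(* x_{t+1} = dyn t x_t u_t + omega_{t+1},  y_{t+1} = obs t x_t + gamma_{t+1},
   x_0 ~ N(xhat0, chi0), omega_t ~ N(0, Omega t), gamma_t ~ N(0, Gamma t)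
   independent, with cost termcost x_T + sum_(t < T) cost t x_t u_t.
   Omega and Gamma are only meaningful at the times 1, ..., T.
   The past stress sees the Gaussian laws through their parameters only. *)
Record model (R : realType) (n m p : nat) := Model {
  dyn : nat -> 'cV[R]_n -> 'cV[R]_m -> 'cV[R]_n;
  obs : nat -> 'cV[R]_n -> 'cV[R]_p;
  cost : nat -> 'cV[R]_n -> 'cV[R]_m -> R;
  termcost : 'cV[R]_n -> R;
  xhat0 : 'cV[R]_n;
  chi0 : 'M[R]_n;
  Omega : nat -> 'M[R]_n;
  Gamma : nat -> 'M[R]_p
}.

Definition model_regular (R : realType) (n m p : nat) (T : nat)
    (M : model R n m p) : Prop :=
  [/\ forall t, (t < T)%N ->
        [/\ C2 (fun z : 'cV[R]_n * 'cV[R]_m => dyn M t z.1 z.2),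
            C2 (obs M t) &
            C2 (fun z : 'cV[R]_n * 'cV[R]_m => cost M t z.1 z.2 : R^o)],
      C2 (termcost M : 'cV[R]_n -> R^o),
      posdef (chi0 M) &
      forall t, (0 < t <= T)%N -> posdef (Omega M t) /\ posdef (Gamma M t)].

(* The nominal trajectory need not satisfy xn t.+1 = dyn t (xn t) (un t). *)
Record nominal (R : realType) (n m : nat) := Nominal {
  xn : nat -> 'cV[R]_n;
  un : nat -> 'cV[R]_m
}.

Section Expansion.
Variables (R : realType) (n m p : nat).
Variables (M : model R n m p) (N : nominal R n m).

Definition fx t : 'M[R]_n := jac (fun x => dyn M t x (un N t)) (xn N t).
Definition fu t : 'M[R]_(n, m) := jac (fun u => dyn M t (xn N t) u) (un N t).
Definition hx t : 'M[R]_(p, n) := jac (obs M t) (xn N t).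

Definition lx t : 'cV[R]_n :=
  grad (fun x => cost M t x (un N t)) (xn N t).
Definition lu t : 'cV[R]_m :=
  grad (fun u => cost M t (xn N t) u) (un N t).
Definition lxx t : 'M[R]_n :=
  jac (fun x => grad (fun x' => cost M t x' (un N t)) x) (xn N t).
Definition lxu t : 'M[R]_(n, m) :=
  jac (fun u => grad (fun x => cost M t x u) (xn N t)) (un N t).
Definition lux t : 'M[R]_(m, n) :=
  jac (fun x => grad (fun u => cost M t x u) (un N t)) (xn N t).
Definition luu t : 'M[R]_m :=
  jac (fun u => grad (fun u' => cost M t (xn N t) u') u) (un N t).

(* [fbar t.+1] is the feasibility gap at time t.+1; there is none at time 0,
   and [fbar 0] is never used. *)
Definition fbar t : 'cV[R]_n :=
  dyn M t.-1 (xn N t.-1) (un N t.-1) - xn N t.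

Definition dcost t (dx : 'cV[R]_n) (du : 'cV[R]_m) : R :=
  2^-1 * qform
    (block_mx (0 : 'M[R]_1) (row_mx (lx t)^T (lu t)^T)
              (col_mx (lx t) (lu t))
              (block_mx (lxx t) (lxu t) (lux t) (luu t)))
    (col_mx (1 : 'M[R]_1) (col_mx dx du)).

(* The recorded controls and observations: u t is used for 0 <= t < T and
   y t for 1 <= t <= T. *)
Variables (u : nat -> 'cV[R]_m) (y : nat -> 'cV[R]_p).

Definition du t : 'cV[R]_m := u t - un N t.
(* Like [fbar], only meaningful at positive times. *)
Definition dy t : 'cV[R]_p := y t - obs M t.-1 (xn N t.-1).

(* [noise_cost t dx' dx] is the discrepancy d_t as a function of
   dx' = delta x_{t-1} and dx = delta x_t, for t > 0. *)
Definition noise_cost t (dx' dx : 'cV[R]_n) : R :=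
  2^-1 * qform (invmx (Omega M t))
    (dx - fx t.-1 *m dx' - fu t.-1 *m du t.-1 - fbar t) +
  2^-1 * qform (invmx (Gamma M t)) (dy t - hx t.-1 *m dx').

Variables (s : sense) (sigma : R).

(* The quantity extremized over dx' = delta x_t to get the past stress at
   delta x_{t+1} = dx, where Pt is the past stress at time t. *)
Definition stress_objective t (Pt : 'cV[R]_n -> R) (dx dx' : 'cV[R]_n) : R :=
  dcost t dx' (du t) + sigma^-1 * noise_cost t.+1 dx' dx + Pt dx'.

(* [past_stress t] only reads u 0, ..., u t.-1 and y 1, ..., y t, that is,
   the information W_t. *)
Fixpoint past_stress t (dx : 'cV[R]_n) : R :=
  match t with
  | 0 => sigma^-1 *
         (2^-1 * qform (invmx (chi0 M)) (xn N 0%N + dx - xhat0 M))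
  | t'.+1 => ext s (stress_objective t' (past_stress t') dx)
  end.

Definition past_stress_attained T : Prop :=
  forall t, (t < T)%N -> forall dx,
    ext_attained s (stress_objective t (past_stress t) dx).

End Expansion.

(* Main.v *)
Require Import Defs.
From mathcomp Require Import all_boot all_order all_algebra.
From mathcomp Require Import all_classical all_reals all_analysis.
From mathcomp Require Import ring lra.
Import Order.TTheory GRing.Theory Num.Theory.
Import numFieldNormedType.Exports.
Local Open Scope ring_scope.

(** The proof is by induction on time. If [sigma] times the past stress at time
    t is half the quadratic form of [invmx P] centred at [xhat], up to a
    constant, then [sigma] times the objective extremized over z = delta x_t is
    a quadratic polynomial in z and dx = delta x_{t+1}. Completing the square
    in z in all the terms other than the state noise gives ([objective_square])

      1/2 |dx - xhat' - f (z - z0)|^2_{Omega^-1} + 1/2 |z - z0|^2_A + constant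

    where A = H^-1, xhat' is the new estimate, z0 = xhat + H g, and g is the
    opposite of the gradient at z = xhat of the terms other than the state
    noise. This uses that the second derivatives of the cost are symmetric,
    hence the theorem on mixed derivatives ([clairaut]).

    The extremum over z of such an expression is then computed by duality
    ([ext_dual], [ext_quadratic]). It is attained by assumption, so it is the
    value at a stationary point. With e = dx - xhat' and the multiplier
    lam = Omega^-1 (e - f (z - z0)), stationarity says A (z - z0) = f^T lam,
    whence e = (Omega + f H f^T) lam = P' lam, and the value is 1/2 lam^T e.
    As dx is arbitrary, P' is onto, hence invertible, and the value is
    1/2 e^T P'^-1 e. Only stationarity enters, so minima and maxima, and both
    signs of [sigma], are treated alike. *)

Set Implicit Arguments.
Unset Strict Implicit.
Unset Printing Implicit Defensive.

(** * Symmetry of second derivatives *)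

Lemma is_derive_line (R : realType) (V : normedModType R) (f : V -> R^o)
    (x v : V) (t : R) :
  derivable f (x + t *: v) v ->
  is_derive t 1 (fun r : R => f (x + r *: v)) ('D_v f (x + t *: v)).
Proof.
move=> fxv.
have E : (fun h : R => h^-1 *: (((fun r : R => f (x + r *: v)) \o shift t)
              (h *: 1) - f (x + t *: v)))
       = (fun h : R => h^-1 *: ((f \o shift (x + t *: v)) (h *: v)
            - f (x + t *: v))).
  apply/funext => h /=; congr (_ *: (f _ - _)).
  by rewrite [h *: 1]mulr1 scalerDl addrCA.
by apply: DeriveDef; rewrite /derivable /derive E.
Qed.

Lemma MVT_line (R : realType) (V : normedModType R) (f : V -> R^o) (x v : V)
    (h : R) :
  0 < h -> (forall z, derivable f z v) ->
  exists2 a, 0 <= a <= h & f (x + h *: v) - f x = 'D_v f (x + a *: v) * h.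
Proof.
move=> h0 fv.
have [||a aI] := @MVT R (fun r => f (x + r *: v))
  (fun r => 'D_v f (x + r *: v)) _ _ h0.
- by move=> r _; apply: is_derive_line.
- apply: derivable_within_continuous => r _.
  by have [] := @is_derive_line R V f x v r (fv _).
rewrite scale0r addr0 subr0 => ->; exists a => //.
by move: aI; rewrite in_itv /= => /andP[/ltW -> /ltW ->].
Qed.

(** Two nested mean value theorems: first along v for the increment of f in the
    direction w, then along w for the derivative of f in the direction v. *)
Lemma second_difference (R : realType) (V : normedModType R) (f : V -> R^o)
    (x v w : V) (h : R) :
  0 < h -> (forall z, derivable f z v) -> (forall z, derivable ('D_v f) z w) ->
  exists a b, [/\ 0 <= a <= h, 0 <= b <= h &
    f (x + h *: v + h *: w) - f (x + h *: v) - (f (x + h *: w) - f x)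
      = 'D_w ('D_v f) (x + a *: v + b *: w) * h * h].
Proof.
move=> h0 fv fvw.
pose g z := f (z + h *: w) - f z : R^o.
have gv z : is_derive z v g ('D_v f (z + h *: w) - 'D_v f z).
  apply: is_deriveB; last exact: DeriveDef.
  have E : (fun k : R => k^-1 *: (((fun z => f (z + h *: w)) \o shift z)
              (k *: v) - f (z + h *: w)))
       = (fun k : R => k^-1 *: ((f \o shift (z + h *: w)) (k *: v)
            - f (z + h *: w))).
    by apply/funext => k /=; rewrite addrA.
  apply: DeriveDef; rewrite /derivable /derive E //; exact: fv.
have [|a aI ga] := @MVT_line R V g x v h h0.
  by move=> z; have [] := gv z.
have [b bI fb] := @MVT_line R V ('D_v f) (x + a *: v) w h h0 fvw.
exists a, b; split=> //; rewrite -fb -(@derive_val _ _ _ _ _ _ _ (gv _)) -ga.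
by rewrite /g.
Qed.

(** The side h is quantified with [near] so that the bounds for the two orders
    of differentiation can be intersected in [continuous_eq_near_corner]. *)
Lemma near_parallelogram (R : realType) (V : normedModType R) (x v w : V)
    (P : V -> Prop) :
  (\forall z \near x, P z) ->
  \forall h \near (0^'+)%classic, forall a b : R, 0 <= a <= h -> 0 <= b <= h ->
    P (x + a *: v + b *: w).
Proof.
move=> /nbhs_ballP[e e0 eP].
have M0 : 0 < `|v| + `|w| + 1 by rewrite ltr_wpDl ?addr_ge0.
near=> h; move=> a b /andP[a0 ah] /andP[b0 bh]; apply: eP.
rewrite -ball_normE /ball_ /= -addrA opprD addNKr normrN.
apply: (@le_lt_trans _ _ (h * (`|v| + `|w| + 1))).
  apply: le_trans (ler_normD _ _) _; rewrite !normrZ !ger0_norm //.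
  rewrite !mulrDr -addrA lerD ?ler_wpM2r // -[leLHS]addr0 lerD ?ler_wpM2r //.
  by rewrite mulr1 (le_trans a0).
rewrite -ltr_pdivlMr //; near: h; apply: nbhs_right_lt; exact: divr_gt0.
Unshelve. all: by end_near. Qed.

(** Two functions that agree up to a displacement inside arbitrarily small
    parallelograms at x have, by continuity, the same value at x. The points
    where they are compared differ, as they come from separate uses of the
    mean value theorem. *)
Lemma continuous_eq_near_corner (R : realType) (V : normedModType R)
    (F G : V -> R^o) (x v w : V) :
  {for x, continuous F} -> {for x, continuous G} ->
  (forall h : R, 0 < h -> exists a b a' b' : R,
     [/\ 0 <= a <= h, 0 <= b <= h, 0 <= a' <= h, 0 <= b' <= h &
       F (x + a *: v + b *: w) = G (x + a' *: w + b' *: v)]) ->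
  F x = G x.
Proof.
move=> Fc Gc FG; apply/eqP; rewrite -subr_eq0 -normr_le0.
apply/ler_addgt0Pl => e e0; rewrite addr0.
have e20 : 0 < e / 2 by rewrite divr_gt0.
have F1 : \forall z \near x, `|F x - F z| < e / 2.
  by have /cvgrPdist_lt := Fc; apply.
have G1 : \forall z \near x, `|G x - G z| < e / 2.
  by have /cvgrPdist_lt := Gc; apply.
have F2 := @near_parallelogram _ _ x v w _ F1.
have G2 := @near_parallelogram _ _ x w v _ G1.
have [h [[h0 hF] hG]] := filter_ex (filterI (filterI (nbhs_right_gt 0) F2) G2).
have [a [b [a' [b' [aI bI aI' bI' E]]]]] := FG h h0.
have h1 := hF a b aI bI; have h2 := hG a' b' aI' bI'; rewrite -E in h2.
have h3 := ler_distD (F (x + a *: v + b *: w)) (F x) (G x).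
rewrite [X in _ <= _ + X]distrC in h3.
apply: (le_trans h3); rewrite [leRHS](splitr e).
by apply: lerD; exact: ltW.
Qed.

(** The second difference of f over the parallelogram with sides h v and h w is
    symmetric in v and w, and it is h^2 times either mixed derivative at a
    point of the parallelogram. *)
Lemma clairaut (R : realType) (V : normedModType R) (f : V -> R^o) (x v w : V) :
  C2 f -> 'D_w ('D_v f) x = 'D_v ('D_w f) x.
Proof.
move=> [_ f1 f2].
have [fv _] := f1 v; have [fw _] := f1 w.
have [fvw Fc] := f2 v w; have [fwv Gc] := f2 w v.
apply: (continuous_eq_near_corner (v := v) (w := w) (Fc x) (Gc x)) => h h0.
have [a [b [aI bI ab]]] := second_difference x h0 fv fvw.
have [a' [b' [aI' bI' ab']]] := second_difference x h0 fw fwv.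
exists a, b, a', b'.
split; [exact: aI|exact: bI|exact: aI'|exact: bI'|].
have hn := lt0r_neq0 h0; apply: (mulIf hn _); apply: (mulIf hn _).
refine (etrans (esym ab) (etrans _ ab')); rewrite (addrAC x (h *: w)).
set p1 := f _; set p2 := f _; set p3 := f _; set p4 := f _.
by rewrite !opprD !opprK !addrA (addrAC p1).
Qed.

Lemma derive_fst (R : realType) (U V : normedModType R) (F : U * V -> R^o)
    (x v : U) (y : V) :
  'D_v (fun z => F (z, y)) x = 'D_(v, 0) F (x, y).
Proof.
have E : (fun h : R => h^-1 *: (((fun z => F (z, y)) \o shift x) (h *: v)
            - F (x, y)))
       = (fun h : R => h^-1 *: ((F \o shift (x, y)) (h *: (v, 0)) - F (x, y))).
  apply/funext => h /=; congr (_ *: (F _ - _)).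
  by congr pair; rewrite /= scaler0 add0r.
by rewrite /derive E.
Qed.

Lemma derive_snd (R : realType) (U V : normedModType R) (F : U * V -> R^o)
    (x : U) (y w : V) :
  'D_w (fun z => F (x, z)) y = 'D_(0, w) F (x, y).
Proof.
have E : (fun h : R => h^-1 *: (((fun z => F (x, z)) \o shift y) (h *: w)
            - F (x, y)))
       = (fun h : R => h^-1 *: ((F \o shift (x, y)) (h *: (0, w)) - F (x, y))).
  apply/funext => h /=; congr (_ *: (F _ - _)).
  by congr pair; rewrite /= scaler0 add0r.
by rewrite /derive E.
Qed.

(** The second derivatives of the cost are iterated partial derivatives; they
    are read here as directional derivatives of the jointly C^2 function of the
    state-control pair, to which the symmetry of mixed derivatives applies. *)
Section Hessian.
Variables (R : realType) (n m p : nat) (M : model R n m p) (N : nominal R n m).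
Variable (t : nat).
Let F (z : 'cV[R]_n * 'cV[R]_m) : R^o := cost M t z.1 z.2.

Lemma lxxE i j :
  lxx M N t i j = 'D_(delta_mx j 0, 0) ('D_(delta_mx i 0, 0) F)
    (xn N t, un N t).
Proof.
have E : (fun x => grad (fun x' => cost M t x' (un N t)) x i 0)
    = (fun x => 'D_(delta_mx i 0, 0) F (x, un N t)).
  by apply/funext => z; rewrite mxE (derive_fst F z (delta_mx i 0) (un N t)).
rewrite mxE E.
by rewrite (derive_fst ('D_(delta_mx i 0, 0) F) (xn N t)
  (delta_mx j 0) (un N t)).
Qed.

Lemma lxuE i j :
  lxu M N t i j = 'D_(0, delta_mx j 0) ('D_(delta_mx i 0, 0) F)
    (xn N t, un N t).
Proof.
have E : (fun v => grad (fun x => cost M t x v) (xn N t) i 0)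
    = (fun v => 'D_(delta_mx i 0, 0) F (xn N t, v)).
  by apply/funext => z; rewrite mxE (derive_fst F (xn N t) (delta_mx i 0) z).
rewrite mxE E.
by rewrite (derive_snd ('D_(delta_mx i 0, 0) F) (xn N t)
  (un N t) (delta_mx j 0)).
Qed.

Lemma luxE i j :
  lux M N t i j = 'D_(delta_mx j 0, 0) ('D_(0, delta_mx i 0) F)
    (xn N t, un N t).
Proof.
have E : (fun x => grad (fun v => cost M t x v) (un N t) i 0)
    = (fun x => 'D_(0, delta_mx i 0) F (x, un N t)).
  by apply/funext => z; rewrite mxE (derive_snd F z (un N t) (delta_mx i 0)).
rewrite mxE E.
by rewrite (derive_fst ('D_(0, delta_mx i 0) F) (xn N t)
  (delta_mx j 0) (un N t)).
Qed.

Hypothesis F_C2 : C2 F.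

Lemma tr_lxx : (lxx M N t)^T = lxx M N t.
Proof. by apply/matrixP => i j; rewrite [LHS]mxE !lxxE; exact: clairaut. Qed.

Lemma lux_tr : lux M N t = (lxu M N t)^T.
Proof.
by apply/matrixP => i j; rewrite [RHS]mxE luxE lxuE; exact: clairaut.
Qed.

End Hessian.

(** * Extremizing a quadratic form *)

Definition dot (R : realType) (k : nat) (a b : 'cV[R]_k) : R := (a^T *m b) 0 0.

Section Dot.
Variables (R : realType) (k : nat).
Implicit Types (a b c : 'cV[R]_k) (A B : 'M[R]_k).

Lemma dotC a b : dot a b = dot b a.
Proof. by rewrite /dot -[in LHS](trmxK b) -trmx_mul mxE. Qed.

Lemma dotDl a b c : dot (a + b) c = dot a c + dot b c.
Proof. by rewrite /dot linearD mulmxDl mxE. Qed.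

Lemma dotDr a b c : dot c (a + b) = dot c a + dot c b.
Proof. by rewrite /dot mulmxDr mxE. Qed.

Lemma dotZl r a b : dot (r *: a) b = r * dot a b.
Proof. by rewrite /dot linearZ -scalemxAl mxE. Qed.

Lemma dotZr r a b : dot a (r *: b) = r * dot a b.
Proof. by rewrite dotC dotZl dotC. Qed.

Lemma dotNl a b : dot (- a) b = - dot a b.
Proof. by rewrite -scaleN1r dotZl mulN1r. Qed.

Lemma dotNr a b : dot a (- b) = - dot a b.
Proof. by rewrite dotC dotNl dotC. Qed.

Lemma dot_eq0 a : (forall v, dot v a = 0) -> a = 0.
Proof.
move=> a0; apply/colP => i; rewrite [RHS]mxE -(a0 (delta_mx i 0)).
by rewrite /dot trmx_delta -rowE mxE.
Qed.

End Dot.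

Lemma dot_mull (R : realType) k l (B : 'M[R]_(k, l)) (a : 'cV_l) (b : 'cV_k) :
  dot (B *m a) b = dot a (B^T *m b).
Proof. by rewrite /dot trmx_mul mulmxA. Qed.

Section Qform.
Variables (R : realType) (k : nat).
Implicit Types (a b c : 'cV[R]_k) (A B : 'M[R]_k).

Lemma qformE A a : qform A a = dot a (A *m a).
Proof. by rewrite /dot mulmxA. Qed.

Lemma qformD A a b : A^T = A ->
  qform A (a + b) = qform A a + qform A b + 2 * dot a (A *m b).
Proof.
move=> sA; rewrite !qformE mulmxDr !dotDl !dotDr.
by rewrite [dot b (A *m a)]dotC dot_mull sA; ring.
Qed.

Lemma qformZ A r a : qform A (r *: a) = r ^+ 2 * qform A a.
Proof. by rewrite !qformE -scalemxAr dotZl dotZr; ring. Qed.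

Lemma qformN A a : qform A (- a) = qform A a.
Proof. by rewrite -scaleN1r qformZ sqrrN expr1n mul1r. Qed.

Lemma qformDm A B a : qform (A + B) a = qform A a + qform B a.
Proof. by rewrite !qformE mulmxDl dotDr. Qed.

Lemma qformZm A r a : qform (r *: A) a = r * qform A a.
Proof. by rewrite !qformE -scalemxAl dotZr. Qed.

Lemma posdef_unitmx A : posdef A -> A \in unitmx.
Proof.
move=> [sA pA]; rewrite -row_free_unit -kermx_eq0; apply/eqP/row_matrixP => i.
rewrite row0; apply/eqP; apply: contraT => ki.
have := pA (row i (kermx A))^T.
rewrite -trmx0 (inj_eq (can_inj (@trmxK _ _ _))) => /(_ ki).
by rewrite /qform trmxK -row_mul mulmx_ker row0 mul0mx mxE ltxx.
Qed.

(** In the covariance recursion, f H f^T has no definite sign, so invertibility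
    is obtained from the solvability of linear systems that the attained
    extrema provide. *)
Lemma surj_unitmx A : (forall b, exists a, A *m a = b) -> A \in unitmx.
Proof.
move=> sA; have [a aE] := choice (fun i => sA (col i 1%:M)).
have : A *m (\matrix_(j, i) a i j 0) = 1%:M.
  apply/matrixP => j i; have /(congr1 (fun c : 'cV_k => c j 0)) := aE i.
  by rewrite !mxE => <-; apply: eq_bigr => l _; rewrite mxE.
by case/mulmx1_unit.
Qed.

End Qform.

Lemma qform_congr (R : realType) k l (A : 'M[R]_l) (f : 'M[R]_(l, k))
    (a : 'cV_k) :
  qform (f^T *m A *m f) a = qform A (f *m a).
Proof. by rewrite !qformE dot_mull !mulmxA. Qed.

Lemma tr_invmx_sym (R : realType) k (A : 'M[R]_k) :
  A^T = A -> (invmx A)^T = invmx A.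
Proof. by move=> sA; rewrite trmx_inv sA. Qed.

(** The witness r = - a / (|b| + 1) makes the linear term dominate, with the
    wrong sign unless a = 0. *)
Lemma quadratic_ge0_linear_eq0 (R : realType) (a b : R) :
  (forall r : R, 0 <= r * a + r ^+ 2 * b) -> a = 0.
Proof.
move=> ge0; apply/eqP; apply: contraT => a0.
have s0 : 0 < (`|b| + 1)^-1 by rewrite invr_gt0 ltr_wpDl.
have := ge0 (- a * (`|b| + 1)^-1); set r := (`|b| + 1)^-1 in s0 *.
have -> : - a * r * a + (- a * r) ^+ 2 * b = a ^+ 2 * r * (r * b - 1) by ring.
have a2 : 0 < a ^+ 2 by rewrite exprn_even_gt0.
rewrite (pmulr_rge0 _ (mulr_gt0 a2 s0)) subr_ge0 -ler_pdivrMl // mulr1 invrK.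
by move=> h; have := ler_norm b; lra.
Qed.

(** An attained extremum is a value; multiplying by a nonzero constant keeps it
    extremal, the sense being reversed when the constant is negative. *)
Lemma ext_eq (R : realType) (X : Type) (s : sense) (g : X -> R) :
  ext_attained s g ->
  exists x, ext s g = g x /\
    forall c : R, c != 0 ->
      (forall y, c * g x <= c * g y) \/ (forall y, c * g y <= c * g x).
Proof.
move=> [x gx]; exists x; split.
- have rx : range g (g x) by exists x.
  have r0 : (range g !=set0)%classic by exists (g x).
  case: s gx => gx; apply/eqP; rewrite eq_le.
  + have lb : lbound (range g) (g x) by move=> _ [y _ <-].
    by rewrite ge_inf //=; [rewrite lb_le_inf|exists (g x)].
  + have ub : ubound (range g) (g x) by move=> _ [y _ <-].
    by rewrite ge_sup //=; rewrite ub_le_sup //; exists (g x).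
- move=> c c0; have [cgt|clt|/eqP] := ltgtP c 0; last by rewrite (negPf c0).
  + by case: s gx => gx; [right|left] => y; rewrite ler_nM2l.
  + by case: s gx => gx; [left|right] => y; rewrite ler_pM2l.
Qed.

Section PartialExtremum.
Variables (R : realType) (k l : nat) (W : 'M[R]_l) (A : 'M[R]_k).
Variables (f : 'M[R]_(l, k)).
Hypotheses (sW : W^T = W) (sA : A^T = A).

Let phi (e : 'cV[R]_l) (x : 'cV[R]_k) :=
  2^-1 * qform W (e - f *m x) + 2^-1 * qform A x.

Lemma phi_line e (x v : 'cV_k) (r : R) :
  phi e (x + r *: v) = phi e x
    + (r * dot v (A *m x - f^T *m (W *m (e - f *m x)))
       + r ^+ 2 * (2^-1 * (qform W (f *m v) + qform A v))).
Proof.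
have cross1 : dot (e - f *m x) (W *m (f *m v))
    = dot v (f^T *m (W *m (e - f *m x))).
  by rewrite dotC !dot_mull sW.
have cross2 : dot x (A *m v) = dot v (A *m x) by rewrite dotC dot_mull sA.
rewrite /phi mulmxDr opprD addrA (qformD (e - f *m x) _ sW) (qformD x _ sA).
rewrite mulmxN -!scalemxAr qformN !qformZ.
rewrite dotNr !dotZr cross1 cross2 dotDr dotNr.
by field.
Qed.

(** First-order condition: along any line phi is a quadratic polynomial, whose
    linear coefficient must vanish at a minimum or a maximum. *)
Lemma phi_stationary e x :
  (forall z, phi e x <= phi e z) \/ (forall z, phi e z <= phi e x) ->
  A *m x = f^T *m (W *m (e - f *m x)).
Proof.
move=> xE; apply/eqP; rewrite -subr_eq0; apply/eqP/dot_eq0 => v.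
set d := dot _ _; pose q := 2^-1 * (qform W (f *m v) + qform A v).
case: xE => xE; last apply: oppr_inj; rewrite ?oppr0.
- apply: (@quadratic_ge0_linear_eq0 _ _ q) => r.
  by have := xE (x + r *: v); rewrite phi_line lerDl.
- apply: (@quadratic_ge0_linear_eq0 _ _ (- q)) => r.
  have := xE (x + r *: v); rewrite phi_line gerDl.
  by rewrite !mulrN -opprD oppr_ge0.
Qed.

End PartialExtremum.

Section ExtQuadratic.
Variables (R : realType) (k l : nat) (Om : 'M[R]_l) (A : 'M[R]_k).
Variables (f : 'M[R]_(l, k)) (b : 'cV[R]_l) (z0 : 'cV[R]_k) (c sigma : R).
Variables (s : sense) (g : 'cV[R]_l -> 'cV[R]_k -> R).
Hypotheses (sOm : Om^T = Om) (uOm : Om \in unitmx).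
Hypotheses (sA : A^T = A) (uA : A \in unitmx) (sigma0 : sigma != 0).
Hypothesis gE : forall dx z, sigma * g dx z =
  2^-1 * qform (invmx Om) (dx - b - f *m (z - z0))
  + 2^-1 * qform A (z - z0) + c.
Hypothesis g_att : forall dx, ext_attained s (g dx).
Let P' := Om + f *m invmx A *m f^T.

(** The multiplier is lam = Om^-1 (e - f x), at an extremal point x and with
    e = dx - b. Stationarity reads A x = f^T lam, so that
    e = Om lam + f x = (Om + f A^-1 f^T) lam, and the extremal value
    1/2 lam^T Om lam + 1/2 x^T A x is 1/2 lam^T e. *)
Lemma ext_dual dx : exists lam,
  P' *m lam = dx - b /\ sigma * ext s (g dx) = 2^-1 * dot lam (dx - b) + c.
Proof.
have [z [-> zE]] := ext_eq (g_att dx).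
set e := dx - b; set x := z - z0.
have st : A *m x = f^T *m (invmx Om *m (e - f *m x)).
  apply: phi_stationary => //; first exact: tr_invmx_sym.
  case: (zE _ sigma0) => h; [left|right] => y; have := h (y + z0);
    by rewrite !gE addrK lerD2r.
pose lam := invmx Om *m (e - f *m x); exists lam.
have Omlam : Om *m lam = e - f *m x by rewrite mulKVmx.
have xE : x = invmx A *m f^T *m lam by rewrite -mulmxA -/lam -st mulKmx.
have P'lam : P' *m lam = e.
  by rewrite mulmxDl Omlam -!mulmxA (mulmxA (invmx A)) -xE subrK.
split=> //; rewrite gE -/e -/x -Omlam !qformE.
rewrite mulKmx // st -/lam -(dot_mull f x lam) [dot _ lam]dotC Omlam.
by rewrite dotDr dotNr [dot _ lam]dotC; field.
Qed.

(** Since an extremum is attained for every dx, the equation P' lam = e is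
    solvable for every e, which makes P' invertible. *)
Lemma ext_quadratic : P' \in unitmx /\ forall dx,
  sigma * ext s (g dx) = 2^-1 * qform (invmx P') (dx - b) + c.
Proof.
have uP : P' \in unitmx.
  apply: surj_unitmx => e; have [lam [lamE _]] := ext_dual (e + b).
  by exists lam; rewrite lamE addrK.
split=> // dx; have [lam [lamE ->]] := ext_dual dx.
by rewrite qformE -[in invmx P' *m _]lamE mulKmx // dotC.
Qed.

End ExtQuadratic.

(** * One step of the recursion *)

Section OneStep.
Variables (R : realType) (n m p : nat) (M : model R n m p) (N : nominal R n m).
Variables (u : nat -> 'cV[R]_m) (y : nat -> 'cV[R]_p) (sigma : R) (t : nat).
Variables (P : 'M[R]_n) (xhat : 'cV[R]_n).

Let Pi := invmx P.
Let Gi := invmx (Gamma M t.+1).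
Let f := fx M N t.
Let h := hx M N t.
Let v := du N u t.
Let r := dy M N y t.+1 - h *m xhat.

(** The Hessian in delta x_t of the sum of [sigma] times the past stress,
    [sigma] times the cost and the observation discrepancy; its inverse is the
    matrix H of the recursion. *)
Definition past_hessian := Pi + h^T *m Gi *m h + sigma *: lxx M N t.

(** The opposite of the gradient of the same function at [xhat]. *)
Definition past_descent :=
  h^T *m (Gi *m r) - sigma *: (lxx M N t *m xhat + lxu M N t *m v + lx M N t).

Definition next_cov := Omega M t.+1 + f *m invmx past_hessian *m f^T.

Definition next_mean :=
  f *m xhat + fu M N t *m v + fbar M N t.+1
  + f *m (invmx past_hessian *m past_descent).

Hypotheses (sxx : (lxx M N t)^T = lxx M N t).
Hypotheses (sux : lux M N t = (lxu M N t)^T).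
Hypotheses (pOm : posdef (Omega M t.+1)) (pGa : posdef (Gamma M t.+1)).
Hypotheses (sigma0 : sigma != 0) (sP : P^T = P).
Hypothesis uA : past_hessian \in unitmx.

Let A := past_hessian.
Let g := past_descent.
Let xhat' := next_mean.
Let z0 := xhat + invmx A *m g.

Let sGi : Gi^T = Gi. Proof. by have [sGa _] := pGa; exact: tr_invmx_sym. Qed.

Lemma tr_past_hessian : A^T = A.
Proof.
rewrite /A /past_hessian !linearD /= linearZ /= !trmx_mul trmxK sxx sGi.
by rewrite tr_invmx_sym // mulmxA.
Qed.

Lemma tr_next_cov : next_cov^T = next_cov.
Proof.
have [sOm _] := pOm; rewrite /next_cov linearD /= !trmx_mul trmxK sOm.
by rewrite tr_invmx_sym ?tr_past_hessian // mulmxA.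
Qed.

Lemma dcostE dx w : dcost M N t dx w =
  2^-1 * qform (lxx M N t) dx + dot dx (lxu M N t *m w + lx M N t)
  + (2^-1 * qform (luu M N t) w + dot w (lu M N t)).
Proof.
have addE (B C : 'M[R]_1) : (B + C) 0 0 = B 0 0 + C 0 0 by rewrite mxE.
have dotE k (a b : 'cV[R]_k) : (a^T *m b) 0 0 = dot a b by [].
rewrite /dcost {1}/qform !tr_col_mx trmx1 -mulmxA !mul_block_col !mul_row_col.
rewrite mul0mx add0r !mulmx1 mul1mx add_col_mx mul_row_col !addE !dotE !dotDr.
rewrite sux [dot w (_ *m dx)]dotC dot_mull trmxK !qformE.
by rewrite [dot (lx _ _ _) _]dotC [dot (lu _ _ _) _]dotC; field.
Qed.

Variables (Pt : 'cV[R]_n -> R) (c : R).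
Hypothesis PtE : forall dx, sigma * Pt dx = 2^-1 * qform Pi (dx - xhat) + c.

(** Everything is expanded in zeta = z - xhat, where the terms other than the
    state noise add up to a constant plus 1/2 zeta^T A zeta - zeta^T g. *)
Lemma objective_square : exists c', forall dx z,
  sigma * stress_objective M N u y sigma t Pt dx z =
  2^-1 * qform (invmx (Omega M t.+1)) (dx - xhat' - f *m (z - z0))
  + 2^-1 * qform A (z - z0) + c'.
Proof.
exists (sigma * (2^-1 * qform (lxx M N t) xhat
                 + dot xhat (lxu M N t *m v + lx M N t)
                 + (2^-1 * qform (luu M N t) v + dot v (lu M N t)))
        + 2^-1 * qform Gi r + c - 2^-1 * qform A (invmx A *m g)) => dx z.
pose zeta := z - xhat; have zE : z = xhat + zeta by rewrite addrC subrK.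
have noiseE : dx - xhat' - f *m (z - z0)
    = dx - f *m z - fu M N t *m v - fbar M N t.+1.
  rewrite /xhat' /next_mean /z0 (mulmxBr _ z) (mulmxDr _ xhat).
  apply/colP => i; rewrite -/A -/g.
  (* Products are abstracted, as [mxE] would expand them into sums. *)
  move: (f *m xhat) (fu M N t *m v) (f *m (invmx A *m g)).
  move: (f *m z) (fbar M N t.+1) => a1 a2 a3 a4 a5.
  by rewrite !mxE; ring.
have costE : qform (lxx M N t) z = qform (lxx M N t) xhat
    + qform (lxx M N t) zeta + 2 * dot zeta (lxx M N t *m xhat).
  by rewrite zE qformD // [dot xhat _]dotC dot_mull sxx.
have obsE : qform Gi (dy M N y t.+1 - h *m z) = qform Gi r
    + qform (h^T *m Gi *m h) zeta - 2 * dot zeta (h^T *m (Gi *m r)).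
  rewrite zE mulmxDr opprD addrA -/r qformD // qformN qform_congr.
  by rewrite mulmxN dotNr [dot r _]dotC !dot_mull sGi; ring.
have AE : qform A (z - z0) = qform Pi zeta
    + qform (h^T *m Gi *m h) zeta + sigma * qform (lxx M N t) zeta
    + qform A (invmx A *m g) - 2 * dot zeta g.
  rewrite /z0 opprD addrA -/zeta qformD ?tr_past_hessian //.
  rewrite qformN mulmxN mulKVmx // dotNr.
  by rewrite {1}/A /past_hessian !qformDm qformZm; ring.
have linE : dot z (lxu M N t *m v + lx M N t)
    = dot xhat (lxu M N t *m v + lx M N t)
      + dot zeta (lxu M N t *m v) + dot zeta (lx M N t).
  by rewrite zE dotDl [dot zeta _]dotDr addrA.
have gE : dot zeta g = dot zeta (h^T *m (Gi *m r))
    - sigma * (dot zeta (lxx M N t *m xhat) + dot zeta (lxu M N t *m v)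
               + dot zeta (lx M N t)).
  by rewrite /g /past_descent dotDr dotNr dotZr !dotDr.
have PtzE := PtE z; rewrite -/zeta in PtzE.
rewrite noiseE AE gE /stress_objective /noise_cost /= -/Gi -/f -/h -/v obsE.
rewrite !(mulrDr sigma) PtzE dcostE costE linE.
by field.
Qed.

Lemma ext_stress_objective (s : sense) :
  (forall dx, ext_attained s (stress_objective M N u y sigma t Pt dx)) ->
  next_cov \in unitmx /\
  exists c', forall dx,
    sigma * ext s (stress_objective M N u y sigma t Pt dx)
      = 2^-1 * qform (invmx next_cov) (dx - next_mean) + c'.
Proof.
move=> att; have [sOm _] := pOm; have [c' objE] := objective_square.
have [uP' extE] := ext_quadratic sOm (posdef_unitmx pOm) tr_past_hessian uA
  sigma0 objE att.
by split=> //; exists c'.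
Qed.

End OneStep.

(** * The past stress *)

Unset Implicit Arguments.

Theorem theoremV1 (R : realType) (n m p T : nat) (sigma : R) (s : sense)
    (M : model R n m p) (N : nominal R n m)
    (u : nat -> 'cV[R]_m) (y : nat -> 'cV[R]_p)
    (P H : nat -> 'M[R]_n) (G : nat -> 'M[R]_(n, p)) (dxhat : nat -> 'cV[R]_n)
    (sigma_neq0 : sigma != 0)
    (M_regular : model_regular T M)
    (ext_exists : past_stress_attained M N u y s sigma T)
    (P_init : P 0%N = chi0 M)
    (dxhat_init : dxhat 0%N = xhat0 M - xn N 0%N)
    (H_inv_exists : forall t, (t < T)%N ->
       invmx (P t) + (hx M N t)^T *m invmx (Gamma M t.+1) *m hx M N t
         + sigma *: lxx M N t \in unitmx)
    (H_def : forall t, (t < T)%N ->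
       H t = invmx (invmx (P t)
                    + (hx M N t)^T *m invmx (Gamma M t.+1) *m hx M N t
                    + sigma *: lxx M N t))
    (G_def : forall t, (t < T)%N ->
       G t = fx M N t *m H t *m (hx M N t)^T *m invmx (Gamma M t.+1))
    (P_rec : forall t, (t < T)%N ->
       P t.+1 = Omega M t.+1 + fx M N t *m H t *m (fx M N t)^T)
    (dxhat_rec : forall t, (t < T)%N ->
       dxhat t.+1 = fx M N t *m dxhat t + fu M N t *m du N u t + fbar M N t.+1
         + G t *m (dy M N y t.+1 - hx M N t *m dxhat t)
         - sigma *: (fx M N t *m H t *m
             (lxx M N t *m dxhat t + lxu M N t *m du N u t + lx M N t))) :
  forall t, (t <= T)%N ->
    P t \in unitmx /\
    exists c : R, forall dx : 'cV[R]_n,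
      sigma * past_stress M N u y s sigma t dx
        = 2^-1 * qform (invmx (P t)) (dx - dxhat t) + c.
Proof.
have [dynR _ [sChi pChi] noiseR] := M_regular.
(* Symmetry of P t is carried along, as completing the square needs it. *)
suff main t : (t <= T)%N -> [/\ (P t)^T = P t, P t \in unitmx &
    exists c : R, forall dx : 'cV[R]_n,
      sigma * past_stress M N u y s sigma t dx
        = 2^-1 * qform (invmx (P t)) (dx - dxhat t) + c].
  by move=> t /main[].
elim: t => [_|t IHt ltT].
  rewrite P_init dxhat_init; split=> //; first exact: posdef_unitmx.
  exists 0 => dx /=.
  by rewrite (mulVKf sigma_neq0) addr0 opprB addrA (addrC dx).
have [sPt uPt [c PtE]] := IHt (ltnW ltT).
have [_ _ costC2] := dynR t ltT.
have [pOm pGa] := noiseR t.+1 ltT.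
have sxx := tr_lxx N costC2; have sux := lux_tr N costC2.
have uA : past_hessian M N sigma t (P t) \in unitmx by exact: H_inv_exists.
have PE : P t.+1 = next_cov M N sigma t (P t) by rewrite P_rec // H_def.
have xE : dxhat t.+1 = next_mean M N u y sigma t (P t) (dxhat t).
  rewrite dxhat_rec // G_def // H_def // /next_mean /past_descent.
  rewrite -/(past_hessian _ _ _ _ _).
  by rewrite !mulmxBr -!scalemxAr !mulmxA !addrA.
have [uP' extE] := ext_stress_objective sxx sux pOm pGa sigma_neq0 sPt uA PtE
  (ext_exists t ltT).
by rewrite PE xE; split=> //; exact: tr_next_cov.
Qed.
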